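(* For $n\ge2$ and $1\le k\le n$, put $r=n-k$ and $$\lambda:=\frac43\binom r2\frac{n-\frac12}{n(n-1)},\quad f_1:=\binom r2(2r-3)\Big(\frac{4}{3n}\cdot\frac{n-\frac12}{n-1}\Big)^2,\quad f_2:=\frac{\binom r2(2r-3)}{\binom n2},$$ $$c_1^A:=r(r-1)\Big(r-\tfrac32\Big)\frac{64}{9n^2}\cdot\frac{(n-\frac12)^2}{(n-1)^2},\qquad c_2^A:=r(r-1)(r-2)\frac{40}{3n^2}\cdot\frac{n(n-\frac{17}{5})+\frac{17}{5}}{(n-1)^2}.$$ Then $$\frac{\binom n2^{r}}{r!}e^{-\lambda}\big(1-e^{\lambda}(f_1+f_2)\big)\le s(n,k)\le\frac{\binom n2^{r}}{r!}e^{-\lambda}\big(1+e^{\lambda}(f_1+f_2)\big),$$ $$\frac{\binom n2^{r}}{r!}e^{-2\lambda}\big(1-e^{2\lambda}(c_1^A+c_2^A)\big)\le S(n,k)\le\frac{\binom n2^{r}}{r!}e^{-2\lambda}\big(1+e^{2\lambda}(c_1^A+c_2^A)\big).$$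
   Context: $s(n,k)$ is the unsigned Stirling number of the first kind (number of permutations of $\{1,\dots,n\}$ with exactly $k$ cycles), and $S(n,k)$ is the Stirling number of the second kind (number of partitions of $\{1,\dots,n\}$ into exactly $k$ nonempty blocks). *)

(* Defs.v *)
From mathcomp Require Import all_boot all_fingroup.
From Stdlib Require Import Reals.

Set Implicit Arguments.
Unset Strict Implicit.
Unset Printing Implicit Defensive.

(* unsigned Stirling number of the first kind: permutations of {0..n-1}
   with exactly k cycles (fixed points count as cycles) *)
Definition stirling1 (n k : nat) : nat :=
  #|[set s : {perm 'I_n} | #|porbits s| == k]|.

Definition stirling2 (n k : nat) : nat :=
  #|[set P : {set {set 'I_n}} | partition P [set: 'I_n] && (#|P| == k)]|.

Local Open Scope R_scope.

Definition bin2R (m : nat) : R := INR ('C(m, 2)).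

Definition lam (n k : nat) : R :=
  let r := (n - k)%nat in
  4 / 3 * bin2R r * (INR n - 1/2) / (INR n * (INR n - 1)).

Definition f1 (n k : nat) : R :=
  let r := (n - k)%nat in
  bin2R r * (2 * INR r - 3) * (4 / (3 * INR n) * ((INR n - 1/2) / (INR n - 1))) ^ 2.

Definition f2 (n k : nat) : R :=
  let r := (n - k)%nat in
  bin2R r * (2 * INR r - 3) / bin2R n.

Definition c1A (n k : nat) : R :=
  let r := INR (n - k)%nat in
  r * (r - 1) * (r - 3/2) * (64 / (9 * INR n ^ 2))
    * ((INR n - 1/2) ^ 2 / (INR n - 1) ^ 2).

Definition c2A (n k : nat) : R :=
  let r := INR (n - k)%nat in
  r * (r - 1) * (r - 2) * (40 / (3 * INR n ^ 2))
    * ((INR n * (INR n - 17/5) + 17/5) / (INR n - 1) ^ 2).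

Definition mainterm (n k : nat) : R :=
  let r := (n - k)%nat in
  bin2R n ^ r / INR (r`!).

(* Main.v *)
Require Import Defs.
From mathcomp Require Import all_boot all_fingroup.
From mathcomp Require Import all_order all_algebra zify.
From mathcomp Require ring lra.
From mathcomp Require Import Rstruct.
From Stdlib Require Import Reals.
From Stdlib Require Lra.
From Coquelicot Require Coquelicot.

(* A placement of r = n - k non-attacking rooks on the triangular board {i < j < n} obeys
   the Stirling recurrences: s(n,k) counts placements with distinct columns, S(n,k)
   placements with distinct columns and distinct rows.  Hence, with N = C(n,2) cells,
   r! s(n,k) / N^r is the probability that r independent uniform cells have no column
   collision, and likewise for S(n,k) with rows and columns.  The number W of colliding
   pairs has mean lambda (resp. 2 lambda), and collisions of disjoint pairs are
   independent, so Chen-Stein compares P(W = 0) with exp(-E W).  The solution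
   g(j+1) = int_0^1 s^j exp(-lambda s) ds of the Stein equation has increments in
   [-1/2, 0], which gives the error (b1 + b2) / 2.  The factor 1/2 is what absorbs, for
   S(n,k), the event that two rooks share a cell. *)

Set Implicit Arguments.
Unset Strict Implicit.
Unset Printing Implicit Defensive.
Import Order.TTheory GRing.Theory Num.Theory.
Delimit Scope nat_scope with N.
Delimit Scope R_scope with R.
Delimit Scope ring_scope with Ri.

(** * Permutations and partitions by corank *)

(** Column [t] of the board has [t] cells. When only columns must differ, all of them are free for a
    new rook: this is the factor of the recurrence for s. When rows must differ too, each earlier
    rook blocks exactly one of them, and the [t - #|R|] cells left correspond to the blocks that a
    new element may join. A collision is indexed by a pair of rooks together with a label (column or
    row), so a single Poisson estimate serves both numbers. Beyond the mean it needs only the joint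
    probabilities for two pairs that coincide or share one rook. For two pairs sharing a rook and
    the same label this is the sum of the cubes of the column heights over N^3, hence exactly 1/N;
    for a row against a column it is merely bounded by 4/n^2, for which [c2A] has room. The estimate
    is purely algebraic over a [realFieldType], with the Stein solution and the value [e0] as
    hypotheses; integrals and exponentials enter only when it is instantiated over the reals. *)

Section PermCount.
Variable T : finType.
Implicit Types (D : {set T}) (s : {perm T}).

(* [r] is the corank [#|T| - #cycles], which turns both Stirling recurrences into
   recurrences in the size of the ground set [D]. *)
Definition permsD D r := [set s | perm_on D s && (#|porbits s| + r == #|T|)].

Lemma card_porbits_le s : #|porbits s| <= #|T|.
Proof. exact: leq_imset_card. Qed.

Lemma porbits1 : #|porbits (1 : {perm T})%g| = #|T|.
Proof.
rewrite card_imset // => x y.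
move=> /setP /(_ y); rewrite porbit_id => /porbitP[i].
by rewrite expg1n perm1 => ->.
Qed.

Lemma card_permsD0 r : #|permsD set0 r| = (r == 0).
Proof.
have -> : permsD set0 r = if r == 0 then [set 1%g] else set0.
  apply/setP=> s; rewrite inE.
  have -> : perm_on set0 s = (s == 1%g).
    apply/idP/eqP=> [h|->]; last by rewrite perm_on1.
    by apply/permP=> x; rewrite perm1; apply: (out_perm h); rewrite inE.
  case: eqP => [->|ne]; rewrite /= ?porbits1.
    by rewrite -{2}[#|T|]addn0 eqn_add2l; case: (r == 0); rewrite inE ?eqxx.
  by case: (r == 0); rewrite inE //; apply/esym/eqP.
by case: (r == 0); rewrite ?cards1 ?cards0.
Qed.

Lemma perm_on_fix D s x : x \notin D -> perm_on D s = perm_on (x |: D) s && (s x == x).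
Proof.
move=> xD; apply/idP/andP=> [h|[h /eqP sx]].
  split; last by rewrite (out_perm h).
  by apply/subsetP=> y /(subsetP h) yD; rewrite !inE yD orbT.
apply/subsetP=> y yE; have := subsetP h y yE; rewrite !inE.
by case/orP=> // /eqP yx; move: yE; rewrite inE yx sx eqxx.
Qed.

Lemma porbit_fix s x y : s x = x -> y != x -> x \notin porbit s y.
Proof.
move=> sx yx; rewrite porbit_sym; apply/porbitP=> -[i yE].
by move: yx; rewrite yE permX iter_fix // eqxx.
Qed.

(** A transposition moving the fixed point [x] merges the cycle [{x}] into that of [y], so exactly
    one cycle is lost unless [y = x]. *)
Lemma card_porbits_tperm s x y : s x = x ->
  #|porbits (tperm x y * s)%g| + (y != x) = #|porbits s|.
Proof.
move=> sx; case: (eqVneq y x) => [->|yx]; first by rewrite tperm1 mul1g addn0.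
have := porbits_mul_tperm s x y; rewrite porbit_fix // eq_sym yx /=.
by rewrite -[(true).*2]/(1 + 1) addnA => /addIn ->.
Qed.

(* Every permutation of [x |: D] is [tperm x y * s] with [s] fixing [x]. *)
Lemma card_permsD_insert D x r : x \notin D ->
  #|permsD (x |: D) r| =
  #|permsD D r| + (if r is r'.+1 then #|D| * #|permsD D r'| else 0).
Proof.
move=> xD.
pose f (p : T * {perm T}) : {perm T} := (tperm x p.1 * p.2)%g.
pose A := setX [set x] (permsD D r).
pose B := if r is r'.+1 then setX D (permsD D r') else set0.
have fI : {in [pred p : T * {perm T} | p.2 x == x] &, injective f}.
  move=> [y s] [y' s'] /eqP/= sx /eqP/= s'x fE.
  have yE : y = y'.
    (* [y] can be read off the product: it is the preimage of [x]. *)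
    have: f (y, s) y = f (y', s') y by rewrite fE.
    rewrite /f /= !permM tpermR sx => h.
    have: s'^-1%g x = tperm x y' y by rewrite {1}h permK.
    have -> : s'^-1%g x = x by rewrite -{1}s'x permK.
    by move=> /(congr1 (tperm x y')); rewrite tpermL tpermK => ->.
  by move: fE; rewrite /f yE => /mulgI /= ->.
have dAB : [disjoint A & B].
  rewrite -setI_eq0; apply/eqP/setP=> -[y s]; rewrite !inE /B.
  case: (r) => [|r'] ; rewrite !inE /= ?andbF //.
  by case: eqP => // ->; rewrite (negPf xD) /= andbF.
have -> : permsD (x |: D) r = f @: (A :|: B).
  apply/setP=> s; apply/idP/imsetP.
    rewrite inE => /andP[sD sr]; exists ((s^-1)%g x, (tperm x (s^-1%g x) * s)%g); last first.
      by rewrite /f /= mulgA tperm2 mul1g.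
    set y := (s^-1)%g x; set s' := (tperm x y * s)%g.
    have s'x : s' x = x by rewrite permM tpermL permKV.
    have yD : y \in x |: D.
      by rewrite -(perm_closed _ sD) permKV setU11.
    have s'D : perm_on D s'.
      rewrite (perm_on_fix _ xD) s'x eqxx andbT perm_onM // .
      apply/subsetP=> z; rewrite inE; case: tpermP => [->|->|]; rewrite ?eqxx //.
      by rewrite setU11.
    have cE : #|porbits s| + (y != x) = #|porbits s'|.
      by rewrite -(card_porbits_tperm y s'x) /s' mulgA tperm2 mul1g.
    rewrite !inE /= s'D -cE; move: yD; rewrite !inE; case: (eqVneq y x) => /= [_ _|yx yD].
      by rewrite addn0 sr.
    case: r sr @A @B dAB => [|r] sr A B dAB; last by rewrite !inE /= yD s'D -cE yx addnAC addn1 -addnS sr.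
    by have := card_porbits_le s'; rewrite -cE yx -(eqP sr) addn0 addn1 ltnn.
case=> -[y s'] h ->; rewrite inE.
have [s'D yD hr] : [/\ perm_on D s', y \in x |: D & #|porbits s'| + r == #|T| + (y != x)].
  move: h; rewrite !inE /= => /orP[/and3P[/eqP-> -> hr]|].
    by rewrite eqxx addn0.
  rewrite /B; case: (r) => [|r']; rewrite !inE //= => /and3P[yD -> hr].
  have yx : y != x by apply: contraNneq xD => <-.
  by rewrite yD orbT yx addnS addn1 eqSS.
have s'x : s' x = x by rewrite (out_perm s'D).
apply/andP; split.
  apply: perm_onM; last by move: s'D; rewrite (perm_on_fix _ xD) => /andP[].
  apply/subsetP=> z; rewrite inE; case: tpermP => [->|->|]; rewrite ?eqxx //.
  by rewrite setU11.
by move: hr; rewrite -(card_porbits_tperm y s'x) addnAC eqn_add2r.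
rewrite card_in_imset; last first.
  apply: sub_in2 fI => -[y s]; rewrite !inE /=.
  have fixx : perm_on D s -> s x == x by move=> h; rewrite (out_perm h).
  case/orP=> [/and3P[_ /fixx]|] //; rewrite /B; case: (r) => [|r']; rewrite !inE //=.
  by case/and3P=> _ /fixx.
rewrite cardsU (eqP (_ : A :&: B == set0)) ?setI_eq0 // cards0 subn0.
rewrite /A cardsX cards1 mul1n /B; congr (_ + _).
by case: (r) => [|r']; rewrite ?cards0 ?cardsX.
Qed.

End PermCount.

Section PartitionCount.
Variable T : finType.
Implicit Types (D B : {set T}) (P Q : {set {set T}}).

Definition partsD D r := [set P | partition P D && (#|P| + r == #|D|)].

Lemma card_partition_le P D : partition P D -> #|P| <= #|D|.
Proof.
move=> hP; rewrite (card_partition hP) -sum1_card; apply: leq_sum => B BP.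
by rewrite card_gt0 (partition_neq0 hP).
Qed.

Lemma card_partsD0 r : #|partsD set0 r| = (r == 0).
Proof.
have -> : partsD set0 r = if r == 0 then [set set0] else set0.
  apply/setP=> P; rewrite inE partition_set0 cards0.
  case: eqP => [->|ne] /=; first by rewrite cards0; case: (r == 0); rewrite inE ?eqxx.
  by case: (r == 0); rewrite inE //; apply/esym/eqP.
by case: (r == 0); rewrite ?cards1 ?cards0.
Qed.

(* The pair [(Q, B)] with [B = set0] stands for adding the new block [[set x]]. *)
Definition add_to_block x (p : {set {set T}} * {set T}) := (x |: p.2) |: (p.1 :\ p.2).

Lemma partition_delete Q D B : partition Q D -> B \in set0 |: Q ->
  partition (Q :\ B) (D :\: B).
Proof.
move=> hQ; rewrite !inE => /orP[/eqP->|]; last exact: partitionD1.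
rewrite setD0 (_ : Q :\ set0 = Q) //; apply/setP=> B'; rewrite !inE.
by case: eqP => // ->; rewrite (partition0 hQ).
Qed.

Lemma block_sub Q D B : partition Q D -> B \in set0 |: Q -> B \subset D.
Proof.
move=> hQ; rewrite !inE => /orP[/eqP->|]; first exact: sub0set.
exact: partitionS.
Qed.

Section Insert.
Variables (D : {set T}) (x : T).
Hypothesis xD : x \notin D.

Lemma add_to_block_partition Q B : partition Q D -> B \in set0 |: Q ->
  partition (add_to_block x (Q, B)) (x |: D).
Proof.
move=> hQ hB; have BD := block_sub hQ hB.
have -> : x |: D = (x |: B) :|: (D :\: B).
  apply/setP=> y; rewrite !inE; case: (y == x) => //=.
  by have := subsetP BD y; case: (y \in B) => //= ->.
apply: partitionU1; first exact: partition_delete.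
  by apply/set0Pn; exists x; rewrite setU11.
rewrite -setI_eq0; apply/eqP/setP=> y; rewrite !inE.
by case: eqP => [->|_] /=; rewrite ?(negPf xD) ?andbF //; case: (y \in B).
Qed.

Lemma notin_delete Q B : partition Q D -> (x |: B) \notin Q :\ B.
Proof.
move=> hQ; apply: contra xD; rewrite !inE => /andP[_ /(partitionS hQ)/subsetP].
by apply; rewrite setU11.
Qed.

Lemma card_add_to_block Q B : partition Q D -> B \in set0 |: Q ->
  #|add_to_block x (Q, B)| = #|Q| + (B == set0).
Proof.
move=> hQ hB; rewrite /add_to_block /= cardsU1 notin_delete // (cardsD1 B Q).
move: hB; rewrite !inE; case: (eqVneq B set0) => [->|_ /= ->].
  by rewrite (partition0 hQ) addnC.
by rewrite addn0.
Qed.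

(** [B] is recovered as the block of [x] with [x] removed, and then [Q] from the remaining blocks;
    an empty [B] fits because no partition contains [set0]. *)
Lemma add_to_block_inj Q B Q' B' :
  partition Q D -> B \in set0 |: Q -> partition Q' D -> B' \in set0 |: Q' ->
  add_to_block x (Q, B) = add_to_block x (Q', B') -> (Q, B) = (Q', B').
Proof.
move=> hQ hB hQ' hB' e.
have xB B1 Q1 : partition Q1 D -> B1 \in set0 |: Q1 -> x \notin B1.
  by move=> h1 h2; apply: contra xD; exact: (subsetP (block_sub h1 h2)).
have pbl B1 Q1 : partition Q1 D -> B1 \in set0 |: Q1 ->
    pblock (add_to_block x (Q1, B1)) x = x |: B1.
  move=> h1 h2; apply: def_pblock; rewrite ?setU11 //.
  exact: partition_trivIset (add_to_block_partition h1 h2).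
have BB : B = B'.
  have: (x |: B) :\ x = (x |: B') :\ x by rewrite -(pbl _ _ hQ hB) e pbl.
  by rewrite (setU1K (xB _ _ hQ hB)) (setU1K (xB _ _ hQ' hB')).
have QQ : Q :\ B = Q' :\ B.
  have: add_to_block x (Q, B) :\ (x |: B) = add_to_block x (Q', B) :\ (x |: B).
    by rewrite e -BB.
  by rewrite !setU1K // notin_delete.
congr (_, _) => //; apply/setP=> C; move/setP: QQ => /(_ C); rewrite !inE.
move: hB hB'; rewrite -BB !inE; case: (eqVneq C B) => //= -> /orP[/eqP-> _|].
  by rewrite (partition0 hQ) (partition0 hQ').
by move=> BQ; rewrite BQ => /orP[/eqP B0|->//]; move: BQ; rewrite B0 (partition0 hQ).
Qed.

Lemma add_to_block_surj P : partition P (x |: D) ->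
  exists Q B, [/\ partition Q D, B \in set0 |: Q & P = add_to_block x (Q, B)].
Proof.
move=> hP; pose C := pblock P x.
have xc : x \in cover P by rewrite (cover_partition hP) setU11.
have CP : C \in P by apply: pblock_mem.
have xC : x \in C by rewrite mem_pblock.
have hPC := partitionD1 hP CP.
have CD := partitionS hP CP.
(* If [x] is alone in its block, that block is dropped and [set0] is the witness; otherwise the
   block merely loses [x]. *)
case: (eqVneq (C :\ x) set0) => [C0|C0].
  have CE : C = [set x] by rewrite -(setD1K xC) C0 setU0.
  exists (P :\ C), set0; rewrite setU11 /add_to_block /= setU0 -CE.
  have -> : D = (x |: D) :\: C by rewrite CE setU1K.
  split=> //; rewrite (_ : P :\ C :\ set0 = P :\ C) ?setD1K //.
  apply/setP=> B; rewrite !inE; case: (eqVneq B set0) => //= ->.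
  by rewrite (partition0 hP) andbF.
exists ((C :\ x) |: (P :\ C)), (C :\ x); split.
- have -> : D = (C :\ x) :|: ((x |: D) :\: C).
    apply/setP=> y; rewrite !inE; have := subsetP CD y; rewrite !inE.
    case: (eqVneq y x) => [->|] /=; first by rewrite xC (negPf xD).
    by case: (y \in C) => //= _ ->.
  apply: partitionU1 => //.
  rewrite -setI_eq0; apply/eqP/setP=> y; rewrite !inE.
  by case: (y \in C); rewrite ?andbF.
- by rewrite !inE eqxx orbT.
rewrite /add_to_block /= setD1K // setU1K ?setD1K //.
(* Were [C :\ x] itself a block of [P], it would meet the block [C] and so equal it, although only
   [C] contains [x]. *)
rewrite !inE negb_and negbK; apply/orP; right; apply/negP => h.
have /set0Pn[y yC] := C0.
have := def_pblock (partition_trivIset hP) h yC.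
have yC' : y \in C by move: yC; rewrite inE => /andP[].
rewrite (def_pblock (partition_trivIset hP) CP yC') => CE.
by move: xC; rewrite CE !inE eqxx.
Qed.

(** The factor [#|D| - r'] is the number of blocks of a partition of [D] of corank [r'], that is,
    the number of existing blocks that [x] can join. Joining one raises the corank by one; a new
    singleton block keeps it. *)
Lemma card_partsD_insert r :
  #|partsD (x |: D) r| = #|partsD D r| +
     (if r is r'.+1 then (#|D| - r') * #|partsD D r'| else 0).
Proof.
pose A := setX (partsD D r) [set (set0 : {set T})].
pose B : {set {set {set T}} * {set T}} :=
  if r is r'.+1 then [set p | (p.1 \in partsD D r') && (p.2 \in p.1)] else set0.
have AB p : p \in A :|: B -> partition p.1 D /\ p.2 \in set0 |: p.1.
  case: p => Q C; rewrite !inE /B.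
  case: (r) => [|r']; rewrite !inE /=.
    by rewrite orbF => /andP[/andP[-> _] ->].
  by case/orP => [/andP[/andP[-> _] ->]//|/andP[/andP[-> _] ->]]; rewrite orbT.
have dAB : [disjoint A & B].
  rewrite -setI_eq0; apply/eqP/setP=> -[Q C]; rewrite !inE /B.
  case: (r) => [|r'] ; rewrite !inE /= ?andbF //.
  case: (eqVneq C set0) => [->|]; rewrite ?andbF //.
  apply/negP => /andP[_ /andP[/andP[hQ _]]]; by rewrite (partition0 hQ).
have -> : partsD (x |: D) r = add_to_block x @: (A :|: B).
  apply/setP=> P; apply/idP/imsetP.
    rewrite inE => /andP[hP]; rewrite cardsU1 xD.
    have [Q [C [hQ hC ->]]] := add_to_block_surj hP.
    rewrite card_add_to_block // => hr; exists (Q, C) => //.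
    rewrite !inE hQ /= /B; move: hC hr; rewrite !inE.
    case: (eqVneq C set0) => [C0 _|C0 /= hC].
      by rewrite addnAC addnC eqn_add2l => ->.
    rewrite andbF; case: (r) => [|r']; last by rewrite !inE hQ hC addn0 addnS eqSS => ->.
    by rewrite !addn0 => /eqP h; have := card_partition_le hQ; rewrite h ltnn.
  case=> -[Q C] h ->; have [/= hQ hC] := AB _ h.
  rewrite inE add_to_block_partition // card_add_to_block // cardsU1 xD.
  move: h; rewrite !inE hQ /= /B; case/orP => [/andP[hr ->]|].
    by rewrite addnAC addnC eqn_add2l.
  case: (r) => [|r']; rewrite !inE //= => /andP[/andP[_ hr] CQ].
  by rewrite (negPf (partition_neq0 hQ CQ)) addn0 addnS eqSS.
rewrite card_in_imset; last first.
  by move=> [Q C] [Q' C'] /AB[/= ? ?] /AB[/= ? ?]; apply: add_to_block_inj.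
rewrite cardsU (eqP (_ : A :&: B == set0)) ?setI_eq0 // cards0 subn0.
rewrite /A cardsX cards1 muln1 /B; congr (_ + _).
case: (r) => [|r']; first by rewrite cards0.
rewrite -sum1_card (eq_bigl (fun p : _ * _ => (p.1 \in partsD D r') && (p.2 \in p.1))) => [|p]; last by rewrite inE.
rewrite -(pair_big_dep (fun Q => Q \in partsD D r') (fun Q C => C \in Q) (fun _ _ => 1)) /=.
rewrite mulnC -sum_nat_const; apply: eq_bigr => Q; rewrite inE => /andP[_ /eqP <-].
by rewrite addnK sum1_card.
Qed.

End Insert.
End PartitionCount.

(** * Rook placements on the triangular board *)

Section RookRecurrence.
Variables (T : finType) (col : T -> nat) (good : pred {set T}).
Implicit Types (R : {set T}) (c : T).
Hypothesis good_sub : forall R R', R' \subset R -> good R -> good R'.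
Hypothesis good_col : forall R, good R -> {in R &, injective col}.
Hypothesis good0 : good set0.

Definition rooks t r :=
  [set R : {set T} | [&& R \subset [set x | col x < t], good R & #|R| == r]].

Lemma card_rooks0 r : #|rooks 0 r| = (r == 0).
Proof.
have -> : rooks 0 r = if r == 0 then [set set0] else set0.
  apply/setP=> R; rewrite inE (_ : [set x | col x < 0] = set0); last first.
    by apply/setP=> x; rewrite !inE.
  rewrite subset0; case: eqP => [->|ne] /=.
    by rewrite good0 cards0; case: r => [|r]; rewrite inE ?eqxx.
  by case: (r == 0); rewrite inE //; apply/esym/eqP.
by case: (r == 0); rewrite ?cards1 ?cards0.
Qed.

(** By [good_col] the last column holds at most one rook; a placement is split according to whether
    it holds one, and that rook is removed. *)
Lemma card_rooksS t r : #|rooks t.+1 r| = #|rooks t r| +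
  (if r is r'.+1 then
     \sum_(R in rooks t r') #|[set c | (col c == t) && good (c |: R)]| else 0).
Proof.
pose A : {set {set T} * T} := if r is r'.+1 then
  [set p | (p.1 \in rooks t r') && (p.2 \in [set c | (col c == t) && good (c |: p.1)])]
  else set0.
pose f (p : {set T} * T) := p.2 |: p.1.
have AP p : p \in A -> [/\ p.1 \subset [set x | col x < t], col p.2 = t,
    good (f p) & #|p.1|.+1 = r].
  rewrite /A; case: (r) => [|r']; rewrite !inE //.
  by case/andP=> /and3P[h1 h2 /eqP->] /andP[/eqP h3 h4].
have notin p : p \in A -> p.2 \notin p.1.
  case/AP=> /subsetP h cE _ _; apply/negP => /h; by rewrite inE cE ltnn.
have -> : rooks t.+1 r = rooks t r :|: f @: A.
  apply/setP=> R; apply/idP/setUP => [|[]].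
  - rewrite inE => /and3P[/subsetP sR gR /eqP cR].
    case: (pickP [pred c in R | col c == t]) => [c /andP[/= cR' /eqP cE]|noc].
      right; apply/imsetP; exists (R :\ c, c); last by rewrite /f setD1K.
      move: cR; rewrite /A; case: (r) => [/eqP|r'] cR.
        by move: cR; rewrite cards_eq0 => /eqP R0; move: cR'; rewrite R0 inE.
      rewrite !inE /= setD1K // gR cE eqxx !andbT.
      apply/and3P; split.
      + apply/subsetP=> x; rewrite !inE => /andP[xc xR].
        have := sR x xR; rewrite inE ltnS leq_eqVlt => /orP[/eqP xt|//].
        by move: xc; rewrite (good_col gR xR cR') ?eqxx // xt.
      + exact: good_sub (subD1set _ _) gR.
      + by move: cR; rewrite (cardsD1 c) cR' add1n => -[->].
    left; rewrite inE gR cR eqxx !andbT; apply/subsetP=> x xR.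
    have := sR x xR; rewrite !inE ltnS leq_eqVlt => /orP[xt|//].
    by have := noc x; rewrite /= xR xt.
  - rewrite !inE => /and3P[/subsetP h -> ->]; rewrite !andbT.
    by apply/subsetP=> x /h; rewrite !inE => /ltnW.
  - case/imsetP=> p pA ->; have [/subsetP h cE gf rE] := AP p pA.
    rewrite inE gf /f cardsU1 (notin _ pA) add1n rE eqxx !andbT.
    apply/subsetP=> x; rewrite !inE => /orP[/eqP->|/h]; first by rewrite cE ltnS.
    by rewrite inE => /ltnW.
rewrite cardsU (_ : _ :&: _ = set0) ?cards0 ?subn0; last first.
  apply/setP=> R; rewrite !inE; apply/negP => /andP[/and3P[/subsetP h _ _]].
  case/imsetP=> p /AP[_ cE _ _] RE; have := h p.2; rewrite RE setU11 inE cE ltnn.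
  by move/(_ isT).
congr (_ + _); rewrite card_in_imset; last first.
  move=> [R c] [R' c'] h h' e.
  have [/= sR cE _ _] := AP _ h; have [/= /subsetP sR' cE' _ _] := AP _ h'.
  have cc : c = c'.
    have: c \in f (R', c') by rewrite -e setU11.
    rewrite !inE => /orP[/eqP//|/sR']; by rewrite inE cE ltnn.
  congr (_, _) => //.
  have: f (R, c) :\ c = f (R', c') :\ c' by rewrite e cc.
  by rewrite (setU1K (notin _ h)) (setU1K (notin _ h')).
rewrite /A; case: (r) => [|r']; first by rewrite cards0.
rewrite -sum1_card (eq_bigl (fun p : _ * _ => (p.1 \in rooks t r') &&
   (p.2 \in [set c | (col c == t) && good (c |: p.1)]))) => [|p]; last by rewrite [LHS]in_set.
rewrite -(pair_big_dep (fun R => R \in rooks t r')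
   (fun R c => c \in [set c | (col c == t) && good (c |: R)]) (fun _ _ => 1)) /=.
by apply: eq_bigr => R _; rewrite sum1_card.
Qed.

End RookRecurrence.

Section Labels.
Variables (T K : finType) (L : eqType) (lab : K -> T -> L).
Implicit Types (R : {set T}).

(** [K] indexes the constraints imposed at once: [unit] will stand for columns alone, [bool] for
    columns and rows. *)
Definition lab_inj R := [forall k, forall x in R, forall y in R,
  (lab k x == lab k y) ==> (x == y)].

Lemma lab_injP R : reflect (forall k, {in R &, injective (lab k)}) (lab_inj R).
Proof.
apply: (iffP forallP) => h k.
  move=> x y xR yR /eqP e; have /forall_inP/(_ x xR)/forall_inP/(_ y yR) := h k.
  by rewrite e => /eqP.
apply/forall_inP=> x xR; apply/forall_inP=> y yR; apply/implyP=> /eqP e.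
by rewrite (h k x y).
Qed.

Lemma lab_inj_sub R R' : R' \subset R -> lab_inj R -> lab_inj R'.
Proof.
move=> /subsetP h /lab_injP g; apply/lab_injP=> k x y xR yR.
by apply: g; apply: h.
Qed.

Lemma lab_inj0 : lab_inj set0.
Proof. by apply/lab_injP=> k x y; rewrite inE. Qed.

(** Each set of size [r] has [r]! enumerations. The label [k0] guarantees at least one constraint,
    which forces [w] itself to be injective. *)
Lemma card_inj_labellings r (k0 : K) :
  #|[set w : {ffun 'I_r -> T} | [forall k, injectiveb (lab k \o w)]]| =
  r`! * #|[set R | lab_inj R & #|R| == r]|.
Proof.
rewrite mulnC -sum_nat_const -sum1_card.
have inj_w (w : {ffun 'I_r -> T}) k : injective (lab k \o w) -> injective w.
  by move=> h i j e; apply: h; rewrite /= e.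
rewrite (partition_big (fun w : {ffun 'I_r -> T} => w @: 'I_r)
   (mem [set R | lab_inj R & #|R| == r])) /=; last first.
  move=> w; rewrite !inE => /forallP h.
  rewrite card_imset ?card_ord ?eqxx ?andbT; last by apply: (inj_w _ k0); exact/injectiveP.
  apply/lab_injP=> k _ _ /imsetP[i _ ->] /imsetP[j _ ->] e.
  by congr (w _); move/injectiveP: (h k); apply.
apply: eq_bigr => R; rewrite inE => /andP[/lab_injP gR /eqP cR].
have := card_inj_ffuns_on 'I_r (mem R).
rewrite (_ : #|[pred x in R]| = r) // card_ord ffactnn => <-.
rewrite -sum1_card; apply: eq_bigl => w; rewrite !inE.
apply/andP/andP => [[/forallP h /eqP wR]|[/ffun_onP wR /injectiveP wI]].
  split; first by apply/ffun_onP => i; rewrite -wR imset_f.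
  by apply/injectiveP; apply: (inj_w _ k0); exact/injectiveP.
split; last first.
  rewrite eqEcard card_imset // card_ord cR leqnn andbT.
  by apply/subsetP=> _ /imsetP[i _ ->]; apply: wR.
apply/forallP => k; apply/injectiveP => i j e; apply: wI.
by apply: gR e; apply: wR.
Qed.
End Labels.

Section Cells.
Variable n : nat.

Definition cell := {p in [pred p : 'I_n * 'I_n | p.1 < p.2]}.
Definition cell_row (x : cell) : 'I_n := (val x).1.
Definition cell_col (x : cell) : 'I_n := (val x).2.

Lemma cell_inj x y : cell_row x = cell_row y -> cell_col x = cell_col y -> x = y.
Proof.
move=> h1 h2; apply: val_inj; move: h1 h2; rewrite /cell_row /cell_col.
by case: (val x) (val y) => ? ? [? ?] /= -> ->.
Qed.

Lemma row_lt_col x : cell_row x < cell_col x.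
Proof. exact: (valP x). Qed.

Lemma cell_exists (i j : 'I_n) : i < j -> exists x, cell_row x = i /\ cell_col x = j.
Proof. by move=> h; exists (Sub (i, j) h). Qed.

Lemma row_imset_col (t : 'I_n) : cell_row @: [set x | cell_col x == t] = [set i : 'I_n | i < t].
Proof.
apply/setP=> i; rewrite inE; apply/imsetP/idP => [[x]|h].
  by rewrite inE => /eqP <- ->; apply: row_lt_col.
by have [x [<- xt]] := cell_exists h; exists x => //; rewrite inE xt.
Qed.

Lemma row_inj_col (t : 'I_n) : {in [set x | cell_col x == t] &, injective cell_row}.
Proof. by move=> x y; rewrite !inE => /eqP xt /eqP yt e; apply: cell_inj; rewrite ?xt. Qed.

Lemma card_ord_lt t : t <= n -> #|[set i : 'I_n | i < t]| = t.
Proof.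
move=> tn; have wI : injective (widen_ord tn) by move=> i j [] /val_inj.
rewrite -[RHS]card_ord -(card_imset _ wI).
apply: eq_card => i; rewrite inE; apply/idP/imsetP => [h|[j _ ->]]; last exact: (ltn_ord j).
by exists (Ordinal h) => //; apply: val_inj.
Qed.

Lemma card_col (t : 'I_n) : #|[set x | cell_col x == t]| = t.
Proof. by rewrite -(card_in_imset (@row_inj_col t)) row_imset_col card_ord_lt // ltnW. Qed.

Definition collab (u : unit) := cell_col.
Definition rclab (b : bool) := if b then cell_col else cell_row.

Lemma card_col_extend (t : nat) (R : {set cell}) : t < n ->
  R \subset [set x | (cell_col x : nat) < t] -> lab_inj collab R ->
  #|[set c | ((cell_col c : nat) == t) && lab_inj collab (c |: R)]| = t.
Proof.
move=> tn /subsetP sR /lab_injP gR; rewrite -[RHS](card_col (Ordinal tn)).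
apply: eq_card => c; rewrite !inE -[in RHS]val_eqE /=.
case: eqP => //= cE; apply/lab_injP=> k x y.
rewrite !inE /collab => /orP[/eqP->|xR] /orP[/eqP->|yR] //= e; last exact: (gR tt).
  by have := sR y yR; rewrite inE -e cE ltnn.
by have := sR x xR; rewrite inE e cE ltnn.
Qed.

(** The cells of column [t] have rows below [t]. The rooks of [R] occupy [#|R|] distinct rows, and
    these are also below [t] since a row index is smaller than its column index; so each rook blocks
    exactly one cell. *)
Lemma card_rc_extend (t : nat) (R : {set cell}) : t < n ->
  R \subset [set x | (cell_col x : nat) < t] -> lab_inj rclab R ->
  #|[set c | ((cell_col c : nat) == t) && lab_inj rclab (c |: R)]| = t - #|R|.
Proof.
move=> tn /subsetP sR /lab_injP gR.
set A := [set c | _].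
have As : A \subset [set x | cell_col x == Ordinal tn].
  by apply/subsetP=> c; rewrite !inE -val_eqE => /andP[].
have rI : {in A &, injective cell_row} by apply: sub_in2 (@row_inj_col (Ordinal tn)) => c; apply/subsetP.
rewrite -(card_in_imset rI).
have -> : cell_row @: A = [set i : 'I_n | i < t] :\: (cell_row @: R).
  apply/setP=> i; apply/imsetP/setDP => [[c]|[]].
    rewrite [c \in A]inE => /andP[/eqP cE /lab_injP gc] ->; split.
      by rewrite inE -cE row_lt_col.
    apply/negP => /imsetP[x xR e].
    have: c = x by apply: (gc false); rewrite ?setU11 // inE xR orbT.
    by move=> cx; have := sR x xR; rewrite inE -cx cE ltnn.
  rewrite inE => it iR; have [c [ri /(congr1 val)/= cE]] := @cell_exists i (Ordinal tn) it.
  exists c => //; rewrite inE cE eqxx /=; apply/lab_injP=> k x y.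
  rewrite !inE => /orP[/eqP->|xR] /orP[/eqP->|yR] //= e; last exact: gR e.
    case: k e => /= e; first by have := sR y yR; rewrite inE -e cE ltnn.
    by case/negP: iR; rewrite -ri e imset_f.
  case: k e => /= e; first by have := sR x xR; rewrite inE e cE ltnn.
  by case/negP: iR; rewrite -ri -e imset_f.
rewrite cardsD (setIidPr _); last first.
  apply/subsetP=> _ /imsetP[x /sR xt ->]; move: xt; rewrite !inE; apply: ltn_trans.
  exact: row_lt_col.
by rewrite card_ord_lt ?(ltnW tn) // card_in_imset //; apply: (gR false).
Qed.

Let Dt t := [set i : 'I_n | i < t].

Lemma Dt_succ t (tn : t < n) : Dt t.+1 = Ordinal tn |: Dt t.
Proof. by apply/setP=> i; rewrite !inE ltnS leq_eqVlt -val_eqE. Qed.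

Lemma Dt_notin t (tn : t < n) : Ordinal tn \notin Dt t.
Proof. by rewrite inE ltnn. Qed.

Lemma card_rooks_perms t r : t <= n ->
  #|rooks cell_col (lab_inj collab) t r| = #|permsD (Dt t) r|.
Proof.
have Hs := @lab_inj_sub _ _ _ collab.
have Hc (R : {set cell}) : lab_inj collab R -> {in R &, injective (fun x => cell_col x : nat)}.
  by move=> /lab_injP h x y xR yR e; apply: (h tt) => //; apply: val_inj.
have H0 := lab_inj0 collab.
elim: t r => [|t IH] r tn.
  have -> : Dt 0 = set0 by apply/setP=> i; rewrite !inE.
  by rewrite card_rooks0 // card_permsD0.
rewrite card_rooksS // (Dt_succ tn) card_permsD_insert ?Dt_notin // IH ?(ltnW tn) //.
congr (_ + _); case: r => // r; rewrite /Dt card_ord_lt ?(ltnW tn) // -IH ?(ltnW tn) //.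
rewrite mulnC -sum_nat_const; apply: eq_bigr => R; rewrite inE => /and3P[h1 h2 _].
exact: card_col_extend.
Qed.

Lemma card_rooks_parts t r : t <= n ->
  #|rooks cell_col (lab_inj rclab) t r| = #|partsD (Dt t) r|.
Proof.
have Hs := @lab_inj_sub _ _ _ rclab.
have Hc (R : {set cell}) : lab_inj rclab R -> {in R &, injective (fun x => cell_col x : nat)}.
  by move=> /lab_injP h x y xR yR e; apply: (h true) => //; apply: val_inj.
have H0 := lab_inj0 rclab.
elim: t r => [|t IH] r tn.
  have -> : Dt 0 = set0 by apply/setP=> i; rewrite !inE.
  by rewrite card_rooks0 // card_partsD0.
rewrite card_rooksS // (Dt_succ tn) card_partsD_insert ?Dt_notin // IH ?(ltnW tn) //.
congr (_ + _); case: r => // r; rewrite /Dt card_ord_lt ?(ltnW tn) // -IH ?(ltnW tn) //.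
rewrite mulnC -sum_nat_const; apply: eq_bigr => R; rewrite inE => /and3P[h1 h2 /eqP h3].
by rewrite -h3; apply: card_rc_extend.
Qed.

Lemma Dt_full : Dt n = setT.
Proof. by apply/setP=> i; rewrite !inE ltn_ord. Qed.

Lemma rooks_full (K : finType) (lab : K -> cell -> 'I_n) r :
  rooks cell_col (lab_inj lab) n r = [set R | lab_inj lab R & #|R| == r].
Proof.
apply/setP=> R; rewrite !inE; case: subsetP => // -[] x _.
by rewrite inE ltn_ord.
Qed.

Lemma stirling1_rooks k : k <= n ->
  (n - k)`! * stirling1 n k =
  #|[set w : {ffun 'I_(n - k) -> cell} | [forall u, injectiveb (collab u \o w)]]|.
Proof.
move=> kn; rewrite (card_inj_labellings collab _ tt) -rooks_full card_rooks_perms //.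
congr (_ * _); apply: eq_card => s; rewrite !inE Dt_full card_ord.
rewrite (_ : perm_on setT s) /=; last by apply/subsetP=> x; rewrite inE.
by rewrite -[in LHS](eqn_add2r (n - k)) subnKC.
Qed.

Lemma stirling2_rooks k : k <= n ->
  (n - k)`! * stirling2 n k =
  #|[set w : {ffun 'I_(n - k) -> cell} | [forall b, injectiveb (rclab b \o w)]]|.
Proof.
move=> kn; rewrite (card_inj_labellings rclab _ true) -rooks_full card_rooks_parts //.
congr (_ * _); apply: eq_card => P; rewrite !inE Dt_full cardsT card_ord.
by rewrite -[in LHS](eqn_add2r (n - k)) subnKC.
Qed.

End Cells.

(** * Power sums of row and column sizes *)

Section CellSums.
Variable n : nat.
Local Notation cell := (cell n).

Lemma sum_by_col (G : nat -> nat) : \sum_(x : cell) G (cell_col x) = \sum_(j < n) j * G j.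
Proof.
rewrite (partition_big (@cell_col n) xpredT) //=; apply: eq_bigr => j _.
rewrite (eq_bigr (fun=> G j)) => [|x /eqP -> //].
by rewrite sum_nat_cond_const card_col.
Qed.

Lemma card_cell : #|{: cell}| = 'C(n, 2).
Proof.
rewrite -sum1_card (sum_by_col (fun=> 1)) -bin2_sum big_mkord.
by apply: eq_bigr => j _; rewrite muln1.
Qed.

Lemma flip_subproof (x : cell) : (rev_ord (cell_col x), rev_ord (cell_row x)) \in
  [pred p : 'I_n * 'I_n | p.1 < p.2].
Proof.
rewrite inE /=; have := row_lt_col x; have := ltn_ord (cell_col x).
have := ltn_ord (cell_row x); lia.
Qed.

(** Reflection of the triangle in its antidiagonal: it exchanges rows and columns, so row statistics
    follow from column statistics. *)
Definition flip (x : cell) : cell := Sub (rev_ord (cell_col x), rev_ord (cell_row x)) (flip_subproof x).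

Lemma row_flip x : cell_row (flip x) = rev_ord (cell_col x).
Proof. by rewrite /cell_row /flip SubK. Qed.

Lemma col_flip x : cell_col (flip x) = rev_ord (cell_row x).
Proof. by rewrite /cell_col /flip SubK. Qed.

Lemma flipK : involutive flip.
Proof. by move=> x; apply: cell_inj; rewrite ?(row_flip, col_flip) rev_ordK. Qed.

Definition fiber (b : bool) (x : cell) := #|[set y : cell | rclab b x == rclab b y]|.

Lemma fiber_col x : fiber true x = cell_col x.
Proof. by rewrite -[RHS]card_col; apply: eq_card => y; rewrite !inE eq_sym. Qed.

Lemma fiber_row x : fiber false x = fiber true (flip x).
Proof.
rewrite /fiber -(card_imset _ (inv_inj flipK)); apply: eq_card => y; rewrite inE /=.
rewrite (can_imset_pre _ flipK) !inE /= row_flip col_flip.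
by rewrite (can2_eq rev_ordK rev_ordK).
Qed.

Lemma sum_fiber b (G : nat -> nat) :
  \sum_(x : cell) G (fiber b x) = \sum_(j < n) j * G j.
Proof.
rewrite -sum_by_col; case: b; first by apply: eq_bigr => x _; rewrite fiber_col.
rewrite (reindex_inj (inv_inj flipK)) /=; apply: eq_bigr => x _.
by rewrite fiber_row flipK fiber_col.
Qed.

Lemma fiber_lt b x : fiber b x < n.
Proof. by case: b; rewrite ?fiber_row fiber_col ltn_ord. Qed.

Lemma sum_squares : 6 * \sum_(j < n) j * j = n * n.-1 * (2 * n - 1).
Proof.
case: n => [|m]; first by rewrite big_ord0.
elim: m => [|m IH]; first by rewrite big_ord_recr big_ord0.
by rewrite big_ord_recr /= mulnDr IH; lia.
Qed.

Lemma sum_cubes : \sum_(j < n) j * (j * j) = 'C(n, 2) * 'C(n, 2).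
Proof.
elim: n => [|m IH]; first by rewrite big_ord0.
rewrite big_ord_recr /= IH binS bin1.
have := bin2 m; have : ~~ odd (m * m.-1) by rewrite oddM; case: (m) => //= k; case: (odd k).
move=> /even_halfK; set h := (_)./2 => hE ->.
by case: (m) hE => [|k] /=; nia.
Qed.

End CellSums.

(** All pairs minus those inside the complement of [A]: C(r,2) - C(r-2,2). The pair [A] itself is
    counted. *)
Lemma card_meeting_pairs r (A : {set 'I_r}) : #|A| = 2 ->
  #|[set B : {set 'I_r} | (#|B| == 2) && ~~ [disjoint A & B]]| = (2 * r - 3).
Proof.
move=> A2.
have r2 : (2 <= r) by rewrite -A2 -[r in (_ <= r)]card_ord max_card.
have := cards_draws (~: A) 2; have := cards_draws [set: 'I_r] 2.
have -> : [set B : {set 'I_r} | B \subset [set: 'I_r] & #|B| == 2] =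
   [set B : {set 'I_r} | (#|B| == 2) && ~~ [disjoint A & B]] :|:
   [set B : {set 'I_r} | B \subset ~: A & #|B| == 2].
  apply/setP=> B; rewrite !inE subsetT -disjoints_subset disjoint_sym.
  by case: (#|B| == 2) => //=; rewrite ?andbT ?orNb ?andbF.
rewrite cardsU (_ : _ :&: _ = set0); last first.
  apply/setP=> B; rewrite !inE -disjoints_subset disjoint_sym.
  by case: [disjoint B & A]; rewrite /= ?andbF.
have -> : #|~: A| = (r - 2) by rewrite cardsCs setCK A2 card_ord.
rewrite cards0 subn0 cardsT card_ord => h1 h2; move: h1; rewrite h2.
case: r A A2 r2 {h2} => [|[|m]] A A2 // _.
have -> : m.+2 - 2 = m by lia.
rewrite !binS !bin0 !bin1; lia.
Qed.

Lemma card_meeting_pairs_neq r (A : {set 'I_r}) : #|A| = 2 ->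
  #|[set B : {set 'I_r} | [&& #|B| == 2, ~~ [disjoint A & B] & B != A]]| = (2 * (r - 2)).
Proof.
move=> A2; have r2 : (2 <= r) by rewrite -A2 -[r in (_ <= r)]card_ord max_card.
have := card_meeting_pairs A2; rewrite (cardsD1 A) inE A2 /=.
have -> : ~~ [disjoint A & A].
  by rewrite -setI_eq0 setIid -cards_eq0 A2.
set U := _ :\ A; set U' := [set _ | _].
have -> : U = U' by apply/setP=> B; rewrite !inE andbC -andbA.
lia.
Qed.

Section RealField.
Import mathcomp.algebra_tactics.ring mathcomp.algebra_tactics.lra.
Local Open Scope ring_scope.


(** * Expectation under the uniform law on a finite set *)

Section Mean.
Variable F : realFieldType.

Definition mean (Om : finType) (g : Om -> F) : F := #|Om|%:R^-1 * \sum_w g w.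

Lemma eq_mean (Om : finType) (g h : Om -> F) : g =1 h -> mean g = mean h.
Proof. by move=> e; congr (_ * _); apply: eq_bigr => w _. Qed.

Lemma meanZ (Om : finType) c (g : Om -> F) : mean (fun w => c * g w) = c * mean g.
Proof. by rewrite /mean -mulr_sumr mulrCA. Qed.

Lemma meanB (Om : finType) (g h : Om -> F) : mean (fun w => g w - h w) = mean g - mean h.
Proof. by rewrite /mean sumrB mulrBr. Qed.

Lemma mean_sum (Om I : finType) (P : pred I) (g : I -> Om -> F) :
  mean (fun w => \sum_(i | P i) g i w) = \sum_(i | P i) mean (g i).
Proof. by rewrite /mean exchange_big mulr_sumr. Qed.

Lemma mean_cst (Om : finType) c : (0 < #|Om|)%N -> mean (fun _ : Om => c) = c.
Proof.
move=> h; rewrite /mean sumr_const -[c *+ _]mulr_natl mulrA mulVf ?mul1r //.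
by rewrite pnatr_eq0 -lt0n.
Qed.

Lemma le_mean (Om : finType) (g h : Om -> F) : (forall w, g w <= h w) -> mean g <= mean h.
Proof.
move=> le; apply: ler_wpM2l; first by rewrite invr_ge0 ler0n.
by apply: ler_sum => w _.
Qed.

Lemma norm_mean (Om : finType) (g : Om -> F) : `|mean g| <= mean (fun w => `|g w|).
Proof.
rewrite /mean normrM ger0_norm ?invr_ge0 ?ler0n //.
by apply: ler_wpM2l; rewrite ?invr_ge0 ?ler0n // ler_norm_sum.
Qed.

Lemma mean_ge0 (Om : finType) (g : Om -> F) : (forall w, 0 <= g w) -> 0 <= mean g.
Proof. by move=> h; rewrite mulr_ge0 ?invr_ge0 ?ler0n ?sumr_ge0. Qed.

Lemma mean_exchange (S T : finType) (g : S -> T -> F) :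
  mean (fun x => mean (g x)) = mean (fun y => mean (g^~ y)).
Proof. by rewrite /mean -!mulr_sumr exchange_big mulrCA. Qed.

End Mean.

(** * The Chen-Stein bound for local dependence *)

Section ChenStein.
Variables (F : realFieldType) (Om I : finType) (X : I -> Om -> bool) (nb : rel I).
Variables (e0 : F) (f : nat -> F).
Let p a := mean (fun w => (X a w)%:R : F).
Let W w := (\sum_a X a w)%N.
Let V a w := (\sum_(b | ~~ nb a b) X b w)%N.
Hypothesis Om_gt0 : (0 < #|Om|)%N.
Hypothesis nbX : forall a w, X a w -> nb a a.
Hypothesis indep : forall a (g : nat -> F),
  mean (fun w => (X a w)%:R * g (V a w)) = p a * mean (fun w => g (V a w)).
Hypothesis f_stein : forall j, (\sum_a p a) * f j.+1 - j%:R * f j = (j == 0%N)%:R - e0.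
Hypothesis f_diff : forall j, `|f j.+1 - f j.+2| <= 2^-1.

(** Only positive arguments are compared, because the Stein equation leaves [f 0] unconstrained. *)
Lemma f_lipschitz j d : `|f (j + d).+1 - f j.+1| <= 2^-1 * d%:R.
Proof.
elim: d => [|d IH]; first by rewrite addn0 subrr normr0 mulr0.
have := f_diff (j + d); rewrite distrC addnS -[d.+1%:R]natr1 mulrDr mulr1 [2^-1 * _ + _]addrC => h.
apply: le_trans (lerD h IH).
by apply: le_trans (ler_normD _ _); rewrite addrA subrK.
Qed.

(** The Stein equation is evaluated at [W] and averaged. [V a] counts the events outside the
    neighbourhood of [a]; being independent of [X a], it mediates between [f (W + 1)] and [f W], and
    the cost is half the number of neighbours that occur. *)
Lemma chen_stein : `|mean (fun w => (W w == 0%N)%:R) - e0| <=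
  2^-1 * (\sum_a \sum_(b | nb a b) p a * p b +
          \sum_a \sum_(b | nb a b && (b != a)) mean (fun w => (X a w && X b w)%:R)).
Proof.
have p0 a : 0 <= p a by apply: mean_ge0 => w; rewrite ler0n.
have WE a w : W w = (V a w + \sum_(b | nb a b) X b w)%N.
  by rewrite /W (bigID (nb a)) addnC.
(* For each [a], the term [p a * mean f(V + 1) = mean (X a * f(V + 1))] is subtracted and added. *)
have -> : mean (fun w => (W w == 0%N)%:R) - e0 =
    \sum_a (p a * mean (fun w => f (W w).+1 - f (V a w).+1) +
            mean (fun w => (X a w)%:R * (f (V a w).+1 - f (W w)))).
  rewrite -[e0 in LHS](@mean_cst F Om) // -meanB.
  rewrite (eq_mean (h := fun w => (\sum_a p a) * f (W w).+1 -
      \sum_a (X a w)%:R * f (W w))); last first.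
    by move=> w; rewrite -f_stein -mulr_suml -natr_sum.
  rewrite meanB meanZ mean_sum mulr_suml -sumrB; apply: eq_bigr => a _.
  rewrite meanB (eq_mean (g := fun w => (X a w)%:R * (_ - _))
    (h := fun w => (X a w)%:R * f (V a w).+1 - (X a w)%:R * f (W w))); last first.
    by move=> w; rewrite mulrBr.
  rewrite meanB (indep a (fun j => f j.+1)); ring.
apply: le_trans (ler_norm_sum _ _ _) _.
rewrite mulrDr !mulr_sumr -big_split /=; apply: ler_sum => a _.
apply: le_trans (ler_normD _ _) _; apply: lerD.
  rewrite normrM ger0_norm // -mulr_sumr mulrCA; apply: ler_wpM2l => //.
  apply: le_trans (norm_mean _) _; rewrite -mean_sum -meanZ; apply: le_mean => w.
  by rewrite (WE a) -natr_sum; apply: f_lipschitz.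
rewrite -mean_sum -meanZ; apply: le_trans (norm_mean _) _; apply: le_mean => w.
case Xa: (X a w); last first.
  by rewrite mul0r normr0 mulr_ge0 ?invr_ge0 ?ler0n // sumr_ge0.
(* On the event [X a], the neighbour [a] itself supplies the 1 in [V + 1], which is why the second
   sum omits [b = a]. *)
rewrite mul1r (WE a) (bigD1 a) ?(nbX Xa) //= Xa add1n addnS distrC.
by apply: le_trans (f_lipschitz _ _) _; rewrite natr_sum.
Qed.

End ChenStein.

(** * Collisions among independent uniform samples *)

Section ProductSpace.
Variables (F : realFieldType) (r : nat) (T : finType).
Let Om := {ffun 'I_r -> T}.
Hypothesis T_gt0 : (0 < #|T|)%N.

Lemma card_Om_gt0 : (0 < #|{: Om}|)%N.
Proof. by rewrite card_ffun expn_gt0 T_gt0. Qed.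

Definition depends_on (U : Type) (A : {set 'I_r}) (g : Om -> U) :=
  forall w w' : Om, {in A, w =1 w'} -> g w = g w'.

Lemma mean_indep A (g h : Om -> F) : depends_on A g -> depends_on (~: A) h ->
  mean (fun w => g w * h w) = mean g * mean h.
Proof.
move=> hg hh.
(* Exchanging the coordinates outside [A] of two independent samples. *)
pose mix (w w' : Om) : Om := [ffun i => if i \in A then w i else w' i].
pose phi (q : Om * Om) := (mix q.1 q.2, mix q.2 q.1).
have phiK : involutive phi.
  by case=> w w'; congr (_, _); apply/ffunP => i; rewrite !ffunE /=; case: (i \in A).
have E1 : mean g * mean h = mean (fun w => mean (fun w' => g w * h w')).
  rewrite mulrC -meanZ; apply: eq_mean => w; by rewrite mulrC -meanZ.
rewrite E1 /mean -mulr_sumr pair_bigA /= (reindex_inj (inv_inj phiK)) /=.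
rewrite (eq_bigr (fun q : Om * Om => g q.1 * h q.1)); last first.
  case=> w w' _ /=; congr (_ * _); [apply: hg|apply: hh] => i; rewrite !ffunE.
    by move=> ->.
  by rewrite inE => /negPf ->.
rewrite -(pair_bigA _ (fun w _ => g w * h w)) /=.
rewrite [in RHS](eq_bigr (fun w => #|{: Om}|%:R * (g w * h w))); last first.
  by move=> w _; rewrite mulr_natl -sumr_const.
rewrite -mulr_sumr mulKf // pnatr_eq0 -lt0n; exact: card_Om_gt0.
Qed.

Definition upd (w : Om) i x : Om := [ffun j => if j == i then x else w j].

(** Swapping the coordinate [w i] with the fresh sample [x] is an involution of the product space,
    so it preserves the uniform law. *)
Lemma mean_resample i (g : Om -> F) : mean g = mean (fun w => mean (fun x => g (upd w i x))).
Proof.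
pose phi (q : Om * T) := (upd q.1 i q.2, q.1 i).
have phiK : involutive phi.
  case=> w x; congr (_, _); last by rewrite ffunE eqxx.
  by apply/ffunP => j; rewrite !ffunE /=; case: eqP => // ->.
rewrite /mean -mulr_sumr pair_bigA /=.
rewrite (reindex_inj (inv_inj phiK)) /=.
rewrite (eq_bigr (fun q : Om * T => g q.1)); last first.
  by case=> w x _; congr (g _); apply/ffunP => j; rewrite !ffunE /=; case: eqP => // ->.
rewrite -(pair_bigA _ (fun w _ => g w)) /=.
rewrite [in RHS](eq_bigr (fun w => #|T|%:R * g w)); last first.
  by move=> w _; rewrite mulr_natl -sumr_const.
by rewrite -mulr_sumr mulKf // pnatr_eq0 -lt0n.
Qed.

Lemma mean_coord1 i (G : T -> F) : mean (fun w : Om => G (w i)) = mean G.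
Proof.
rewrite (mean_resample i); under eq_mean => w do under eq_mean => x do rewrite ffunE eqxx.
by rewrite mean_cst // card_Om_gt0.
Qed.

Lemma mean_coord2 i j (G : T -> T -> F) : i != j ->
  mean (fun w : Om => G (w i) (w j)) = mean (fun x => mean (G x)).
Proof.
move=> ij; rewrite (mean_resample i).
under eq_mean => w do under eq_mean => x do rewrite !ffunE eqxx eq_sym (negPf ij).
by rewrite mean_exchange; apply: eq_mean => x; rewrite mean_coord1.
Qed.

Lemma mean_coord3 i j k (G : T -> T -> T -> F) : i != j -> i != k -> j != k ->
  mean (fun w : Om => G (w i) (w j) (w k)) =
  mean (fun x => mean (fun y => mean (G x y))).
Proof.
move=> ij ik jk; rewrite (mean_resample i).
under eq_mean => w do under eq_mean => x do
  rewrite !ffunE eqxx ![_ == i]eq_sym (negPf ij) (negPf ik).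
by rewrite mean_exchange; apply: eq_mean => x; rewrite (mean_coord2 (G x)).
Qed.

End ProductSpace.

Section Collisions.
Variables (F : realFieldType) (r : nat) (T K : finType) (L : eqType).
Variable lab : K -> T -> L.
Hypothesis T_gt0 : (0 < #|T|)%N.
Let Om := {ffun 'I_r -> T}.
Implicit Types (A B : {set 'I_r}) (k : K) (w : Om).

Definition collision k : F := mean (fun x => mean (fun y => (lab k x == lab k y)%:R)).
Definition collision_both k k' : F :=
  mean (fun x => mean (fun y => ((lab k x == lab k y) && (lab k' x == lab k' y))%:R)).
(** Joint probability for two pairs with exactly one common index, whose sample is [x]. *)
Definition collision_chain k k' : F :=
  mean (fun x => mean (fun y => mean (fun z =>
    ((lab k x == lab k y) && (lab k' x == lab k' z))%:R))).

(* Indexing pairs of coordinates by all sets [A], with [collides] false unless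
   [#|A| = 2%N], lets the neighbourhoods be counted with binomials. *)
Definition collides (a : {set 'I_r} * K) w : bool :=
  (#|a.1| == 2%N) && [forall i in a.1, forall j in a.1, lab a.2 (w i) == lab a.2 (w j)].

Definition meets (a b : {set 'I_r} * K) := ~~ [disjoint a.1 & b.1].

Lemma collidesE i j k w : i != j ->
  collides ([set i; j], k) w = (lab k (w i) == lab k (w j)).
Proof.
move=> ij; rewrite /collides cards2 ij /=; apply/forall_inP/idP => [h|/eqP e].
  by have /forall_inP/(_ j) := h i (set21 _ _); rewrite set22 => /(_ isT).
move=> i' hi; apply/forall_inP=> j'; move: hi; rewrite !inE.
by case/orP=> /eqP-> /orP[] /eqP->; rewrite ?e.
Qed.

Lemma depends_collides a : depends_on a.1 (collides a).
Proof.
move=> w w' e; congr (_ && _); apply: eq_forallb_in => i iA.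
by apply: eq_forallb_in => j jA; rewrite !e.
Qed.

Lemma mean_collides A k :
  mean (fun w : Om => (collides (A, k) w)%:R) = (#|A| == 2%N)%:R * collision k.
Proof.
case: cards2P => [[i [j [ij ->]]]|nA].
  rewrite mul1r /collision -(mean_coord2 T_gt0 (fun x y => (lab k x == lab k y)%:R) ij).
  by apply: eq_mean => w; rewrite collidesE.
rewrite mul0r -[RHS](@mean_cst F Om) ?card_Om_gt0 //; apply: eq_mean => w.
by rewrite /collides /=; case: cards2P.
Qed.

Lemma mean_collides2 A k k' : #|A| = 2%N ->
  mean (fun w : Om => (collides (A, k) w && collides (A, k') w)%:R) = collision_both k k'.
Proof.
move=> /eqP/cards2P[i [j [ij ->]]].
rewrite /collision_both -(mean_coord2 T_gt0 (fun x y =>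
  ((lab k x == lab k y) && (lab k' x == lab k' y))%:R) ij).
by apply: eq_mean => w; rewrite !collidesE.
Qed.

Lemma mean_collides3 A B k k' : #|A| = 2%N -> #|B| = 2%N -> ~~ [disjoint A & B] -> B != A ->
  mean (fun w : Om => (collides (A, k) w && collides (B, k') w)%:R) = collision_chain k k'.
Proof.
move=> A2 B2 mAB BA.
have [i [iA iB]] : exists i, i \in A /\ i \in B.
  by move: mAB; rewrite -setI_eq0 => /set0Pn[i]; rewrite inE => /andP[]; exists i.
have pairE (C : {set _}) : #|C| = 2%N -> i \in C -> exists j, i != j /\ C = [set i; j].
  move=> C2 iC; have /eqP/cards1P[j Cj] : #|C :\ i| = 1%N.
    by move: C2; rewrite (cardsD1 i) iC => -[].
  exists j; rewrite -Cj setD1K //; split=> //.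
  have: j \in C :\ i by rewrite Cj set11.
  by rewrite !inE eq_sym => /andP[].
have [j [ij AE]] := pairE A A2 iA; have [l [il BE]] := pairE B B2 iB.
have jl : j != l by apply: contraNneq BA => jl; rewrite AE BE jl.
rewrite /collision_chain -(mean_coord3 T_gt0 (fun x y z =>
  ((lab k x == lab k y) && (lab k' x == lab k' z))%:R) ij il jl).
by apply: eq_mean => w; rewrite AE BE !collidesE.
Qed.

Lemma no_collision w : (\sum_a collides a w == 0)%N = [forall k, injectiveb (lab k \o w)].
Proof.
rewrite sum_nat_eq0; apply/forallP/forallP => [h k|h [A k]].
  apply/injectiveP => i j e; apply/eqP; apply: contraT => ij.
  by have := h ([set i; j], k); rewrite collidesE // [lab k _]e eqxx.
rewrite /= eqb0; apply/negP => cA; have /andP[/= /cards2P[i [j [ij AE]]] _] := cA.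
move: cA; rewrite AE collidesE // => /eqP e.
by move: ij; rewrite (injectiveP _ (h k) i j e) eqxx.
Qed.

Variables (e0 : F) (f : nat -> F).
Hypothesis f_stein : forall j,
  ('C(r, 2%N)%:R * \sum_k collision k) * f j.+1 - j%:R * f j = (j == 0%N)%:R - e0.
Hypothesis f_diff : forall j, `|f j.+1 - f j.+2| <= 2^-1.

Lemma sum_pairs (G : {set 'I_r} -> F) (c : F) : (forall A, #|A| = 2%N -> G A = c) ->
  \sum_(A : {set 'I_r}) (#|A| == 2%N)%:R * G A = 'C(r, 2%N)%:R * c.
Proof.
move=> h; rewrite -[r in 'C(r, 2%N)]card_ord -card_draws -sum1_card natr_sum mulr_suml.
rewrite [RHS]big_mkcond; apply: eq_bigr => A _; rewrite inE.
by case: eqP => [/h ->|_]; rewrite ?mul0r.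
Qed.

(** The neighbours of [(A, k)] are all [(B, k')] with [B] meeting [A], whatever the label. The three
    terms are the products of probabilities, the joint events with [B = A] and another label, and
    those with [B] sharing one index with [A]. *)
Theorem no_collision_poisson :
  `|mean (fun w : Om => [forall k, injectiveb (lab k \o w)]%:R) - e0| <=
  2^-1 * ('C(r, 2%N)%:R * ((2 * r - 3)%:R * (\sum_k collision k) ^+ 2 +
      \sum_k \sum_(k' | k' != k) collision_both k k' +
      (2 * (r - 2))%:R * \sum_k \sum_k' collision_chain k k')).
Proof.
have sumP (G : {set 'I_r} * K -> F) : \sum_a G a = \sum_(A : {set 'I_r}) \sum_k G (A, k).
  by rewrite pair_bigA; apply: eq_bigr => -[].
have sumPc (P : pred ({set 'I_r} * K)) (G : {set 'I_r} * K -> F) :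
    \sum_(a | P a) G a = \sum_(A : {set 'I_r}) \sum_(k | P (A, k)) G (A, k).
  by rewrite pair_big_dep; apply: eq_big => -[].
have lamE : \sum_a mean (fun w : Om => (collides a w)%:R : F) =
    'C(r, 2%N)%:R * \sum_k collision k.
  rewrite sumP -(sum_pairs (G := fun=> \sum_k collision k)) //.
  apply: eq_bigr => A _; rewrite mulr_sumr; apply: eq_bigr => k _.
  exact: mean_collides.
have := @chen_stein F {: Om} _ collides meets e0 f (card_Om_gt0 r T_gt0).
move=> CS; have {CS} := CS _ _ _ f_diff.
rewrite (eq_mean (h := fun w : Om => [forall k, injectiveb (lab k \o w)]%:R)); last first.
  by move=> w; rewrite no_collision.
move=> CS; apply: le_trans (CS _ _ _) _ => [[A k] w|[A k] g|j|].
- rewrite /meets /= => /andP[/= /eqP A2 _].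
  by rewrite -setI_eq0 setIid -cards_eq0 A2.
(* A collision depends only on the coordinates in its pair, and the pairs counted by [V] avoid
   [A]. *)
- apply: (mean_indep T_gt0 (A := A)) => w w' e.
    by congr (_%:R); congr nat_of_bool; apply: (depends_collides (a := (A, k))) e.
  congr g; apply: eq_bigr => b; rewrite /meets negbK /= => dAb.
  congr nat_of_bool; apply: depends_collides => i ib; apply: e.
  by rewrite inE; apply: contraTN dAb => iA; apply/pred0Pn; exists i; rewrite /= iA.
- by rewrite lamE f_stein.
apply: ler_wpM2l; first by rewrite invr_ge0 ler0n.
rewrite -addrA mulrDr; apply: lerD.
  rewrite le_eqVlt; apply/orP; left; apply/eqP.
  rewrite sumP -(sum_pairs (G := fun A => (2 * r - 3)%:R * (\sum_k collision k) ^+ 2)) //.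
  apply: eq_bigr => A _.
  case: (eqVneq #|A| 2%N) => A2; last first.
    rewrite mul0r big1 // => k _; rewrite big1 // => b _.
    by rewrite mean_collides (negPf A2) !mul0r.
  rewrite mul1r -(card_meeting_pairs A2) -sum1_card natr_sum.
  rewrite expr2 mulrCA mulr_suml; apply: eq_bigr => k _.
  rewrite -mulr_sumr mean_collides A2 mul1r; congr (_ * _); rewrite sumPc.
  rewrite mulr_suml [RHS]big_mkcond; apply: eq_bigr => B _; rewrite /meets /= inE.
  case: ifP => [/andP[B2 ->]|].
    by rewrite mul1r; apply: eq_bigr => k' _; rewrite mean_collides B2 mul1r.
  case: (boolP [disjoint A & B]) => dAB; first by rewrite big_pred0.
  rewrite andbT => B2; rewrite big1 // => k' _.
  by rewrite mean_collides B2 mul0r.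
rewrite le_eqVlt; apply/orP; left; apply/eqP.
rewrite sumP -(sum_pairs (G := fun A => \sum_k \sum_(k' | k' != k) collision_both k k' +
      (2 * (r - 2))%:R * \sum_k \sum_k' collision_chain k k')) //.
apply: eq_bigr => A _.
case: (eqVneq #|A| 2%N) => A2; last first.
  rewrite mul0r big1 // => k _; rewrite big1 // => b _.
  by rewrite -[RHS](@mean_cst F Om) ?card_Om_gt0 //; apply: eq_mean => w; rewrite {1}/collides (negPf A2).
rewrite mul1r -(card_meeting_pairs_neq A2) -sum1_card natr_sum mulr_sumr -big_split.
apply: eq_bigr => k _ /=; rewrite sumPc (bigD1 A) //=; congr (_ + _).
  rewrite /meets /=; apply: eq_big => [k'|k' _]; last by rewrite mean_collides2.
  by rewrite -setI_eq0 setIid -cards_eq0 A2 /= xpair_eqE eqxx.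
rewrite mulr_suml [RHS]big_mkcond [LHS]big_mkcond; apply: eq_bigr => B _.
rewrite /meets /= inE; case: (eqVneq B A) => BA; first by rewrite !andbF.
rewrite andbT mul1r.
case: (boolP [disjoint A & B]) => dAB; first by rewrite big_pred0 // andbF.
case: (eqVneq #|B| 2%N) => B2 /=.
  apply: eq_big => k'; first by rewrite xpair_eqE negb_and BA.
  by move=> _; apply: mean_collides3.
rewrite big1 // => k' _.
rewrite -[RHS](@mean_cst F Om) ?card_Om_gt0 //; apply: eq_mean => w.
by rewrite /collides (negPf B2) andbF.
Qed.

End Collisions.

(** * Collision probabilities on the triangular board *)


Section CellMeans.
Variables (F : realFieldType) (n : nat).
Hypothesis n2 : (2 <= n)%N.
Local Notation cell := (cell n).
Local Notation nn := (n%:R : F).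
Local Notation N := ('C(n, 2)%:R : F).
Local Notation p := (4 / 3 * (nn - 2^-1) / (nn * (nn - 1))).

Lemma nn_ge2 : 2 <= nn.
Proof. by rewrite ler_nat. Qed.

Lemma binF (m : nat) : 'C(m, 2)%:R = m%:R * (m%:R - 1) / 2 :> F.
Proof.
elim: m => [|m IH]; first by rewrite bin0n !mul0r.
by rewrite binS bin1 natrD IH -[m.+1%:R]natr1; field.
Qed.

Lemma N_gt0 : 0 < N.
Proof. by rewrite ltr0n bin_gt0. Qed.

Lemma cell_gt0 : (0 < #|{: cell}|)%N.
Proof. by rewrite card_cell bin_gt0. Qed.

Lemma mean_fiber b (x : cell) :
  mean (fun y => (rclab b x == rclab b y)%:R) = N^-1 * (fiber b x)%:R.
Proof.
rewrite /mean card_cell /fiber -sum1_card -natr_sum; congr (_ * _%:R).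
by rewrite [RHS]big_mkcond; apply: eq_bigr => y _; rewrite inE; case: eqP.
Qed.

(** Column [j] has [j] cells, so the probability is the sum of the [j]^2 over N^2; rows have the
    same sizes. *)
Lemma collision_rc b : collision F (@rclab n) b = p.
Proof.
rewrite /collision; under eq_mean => x do rewrite mean_fiber.
rewrite meanZ /mean card_cell -natr_sum (@sum_fiber n b (fun j => j)).
have := congr1 (fun m => m%:R : F) (sum_squares n).
rewrite /= !natrM natrB ?natrM; last by lia.
rewrite -subn1 natrB; last by lia.
have := nn_ge2; have := binF n => -> h2 h.
have -> : (\sum_(j < n) j * j)%N%:R = nn * (nn - 1) * (2 * nn - 1) / 6 :> F.
  by rewrite -h; field.
by field; rewrite subr_eq0; apply/andP; split; apply/eqP; lra.
Qed.

Lemma collision_chain_same b : collision_chain F (@rclab n) b b = N^-1.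
Proof.
rewrite /collision_chain.
rewrite (eq_mean (h := fun x => N^-1 * N^-1 * (fiber b x * fiber b x)%:R)); last first.
  move=> x; rewrite (eq_mean (h := fun y => N^-1 * (fiber b x)%:R *
    (rclab b x == rclab b y)%:R)); last first.
    move=> y; rewrite -(mean_fiber b x) mulrC -meanZ; apply: eq_mean => z.
    by rewrite -natrM mulnb.
  by rewrite meanZ mean_fiber natrM; ring.
rewrite meanZ /mean card_cell -natr_sum (@sum_fiber n b (fun j => j * j)%N) sum_cubes natrM.
by field; rewrite gt_eqF // N_gt0.
Qed.

(* Every row and column has fewer than [n] cells, hence probability at most [2 / n]. *)
Lemma collision_chain_le b c : collision_chain F (@rclab n) b c <= 4 / nn ^+ 2.
Proof.
have N0 := N_gt0.
have fl b' x : mean (fun y : cell => (rclab b' x == rclab b' y)%:R) <= 2 / nn.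
  rewrite mean_fiber; have := nn_ge2 => h.
  have h1 : (fiber b' x)%:R <= nn - 1 :> F.
    by rewrite lerBrDr natr1 ler_nat; apply: fiber_lt.
  apply: le_trans (ler_wpM2l _ h1) _; first by rewrite invr_ge0 ltW.
  rewrite binF le_eqVlt; apply/orP; left; apply/eqP.
  by field; rewrite subr_eq0; apply/andP; split; apply/eqP; lra.
have h0 : 0 <= 2 / nn by rewrite divr_ge0 ?ler0n.
have -> : 4 / nn ^+ 2 = mean (fun _ : cell => (2 / nn) * (2 / nn)) :> F.
  rewrite mean_cst ?cell_gt0 //; have := nn_ge2 => h.
  by field; apply/eqP; lra.
apply: le_mean => x.
rewrite (eq_mean (h := fun y => mean (fun z : cell => (rclab c x == rclab c z)%:R) *
    (rclab b x == rclab b y)%:R)); last first.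
  by move=> y; rewrite mulrC -meanZ; apply: eq_mean => z; rewrite -natrM mulnb.
rewrite meanZ; apply: ler_pM => //; apply: mean_ge0 => y; exact: ler0n.
Qed.

(** Two cells agreeing in row and column are the same cell. *)
Lemma collision_both_rc b c : b != c -> collision_both F (@rclab n) b c = N^-1.
Proof.
move=> bc; rewrite /collision_both -[RHS](@mean_cst F cell) ?cell_gt0 //.
apply: eq_mean => x; rewrite /mean card_cell (bigD1 x) //= !eqxx /=.
rewrite big1 ?addr0 ?mulr1 // => y yx; case: andP => // -[/eqP e1 /eqP e2].
case/eqP: yx; apply: cell_inj; [move: e1 e2|move: e1 e2];
  by case: (b) (c) bc => -[] //= _ -> //.
Qed.

Section Bounds.
Variables (k : nat) (e0 : F) (f : nat -> F).
Hypothesis kn : (k <= n)%N.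
Let r := (n - k)%N.
Hypothesis f_diff : forall j, `|f j.+1 - f j.+2| <= 2^-1.
Local Notation Cr := ('C(r, 2)%:R : F).

Lemma stirling1_poisson :
  (forall j, Cr * p * f j.+1 - j%:R * f j = (j == 0%N)%:R - e0) ->
  `|(r`!)%:R * (stirling1 n k)%:R / N ^+ r - e0| <=
  2^-1 * (Cr * ((2 * r - 3)%:R * p ^+ 2 + (2 * (r - 2))%:R * N^-1)).
Proof.
move=> f_stein.
have sumu (g : unit -> F) : \sum_u g u = g tt by rewrite (big_pred1 tt) // => -[].
have pE : \sum_u collision F (@collab n) u = p.
  by rewrite sumu -(collision_rc true).
have := @no_collision_poisson F r cell unit _ (@collab n) cell_gt0 e0 f.
rewrite pE => /(_ f_stein f_diff); rewrite big1 ?addr0; last first.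
  by move=> u _; rewrite big_pred0 // => -[]; case: u.
have -> : \sum_u \sum_u' collision_chain F (@collab n) u u' = N^-1.
  by rewrite !sumu -(collision_chain_same true).
suff -> : mean (fun w : {ffun 'I_r -> cell} =>
   [forall u, injectiveb (collab u \o w)]%:R) = (r`!)%:R * (stirling1 n k)%:R / N ^+ r by [].
rewrite -natrM stirling1_rooks // /mean card_ffun card_cell card_ord natrX mulrC.
rewrite -natr_sum -sum1_card; congr (_%:R / _).
by rewrite [RHS]big_mkcond; apply: eq_bigr => w _; rewrite inE; case: ifP.
Qed.

Lemma stirling2_poisson :
  (forall j, Cr * (2 * p) * f j.+1 - j%:R * f j = (j == 0%N)%:R - e0) ->
  `|(r`!)%:R * (stirling2 n k)%:R / N ^+ r - e0| <=
  2^-1 * (Cr * ((2 * r - 3)%:R * (2 * p) ^+ 2 + 2 * N^-1 +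
     (2 * (r - 2))%:R * (2 * N^-1 + 2 * (4 / nn ^+ 2)))).
Proof.
move=> f_stein.
have sumb (g : bool -> F) : \sum_b g b = g true + g false.
  exact: big_bool.
have pE : \sum_b collision F (@rclab n) b = 2 * p.
  by rewrite sumb !collision_rc [RHS]mulr_natl mulr2n.
have := @no_collision_poisson F r cell bool _ (@rclab n) cell_gt0 e0 f.
rewrite pE => /(_ f_stein f_diff) h.
have bE : \sum_b \sum_(c | c != b) collision_both F (@rclab n) b c = 2 * N^-1.
  rewrite sumb (big_pred1 false) => [|[]] //; rewrite (big_pred1 true) => [|[]] //.
  by rewrite !collision_both_rc //; ring.
rewrite bE in h.
have -> : (r`!)%:R * (stirling2 n k)%:R / N ^+ r = mean (fun w : {ffun 'I_r -> cell} =>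
   [forall b, injectiveb (rclab b \o w)]%:R).
  rewrite -natrM stirling2_rooks // /mean card_ffun card_cell card_ord natrX mulrC.
  rewrite -natr_sum -sum1_card; congr (_ * _%:R).
  by rewrite [LHS]big_mkcond; apply: eq_bigr => w _; rewrite inE; case: ifP.
apply: le_trans h _; apply: ler_wpM2l; first by rewrite invr_ge0 ler0n.
apply: ler_wpM2l; first exact: ler0n.
apply: lerD => //; apply: ler_wpM2l; first exact: ler0n.
rewrite !sumb !collision_chain_same.
have := collision_chain_le true false; have := collision_chain_le false true; lra.
Qed.

End Bounds.
End CellMeans.

End RealField.

(** * The Stein equation for the Poisson law at 0 *)

Section Stein.
Import Lra Coquelicot.Coquelicot.
Local Open Scope R_scope.

Definition stein_int (lam : R) (j : nat) : R := RInt (fun s => s ^ j * exp (- lam * s)) 0 1.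

Lemma is_stein_int lam j :
  is_RInt (V := R_NormedModule) (fun s => s ^ j * exp (- lam * s)) 0 1 (stein_int lam j).
Proof.
apply: (RInt_correct (V := R_CompleteNormedModule)).
apply: (ex_RInt_continuous (V := R_CompleteNormedModule)) => s _.
by apply: (ex_derive_continuous (V := R_NormedModule)); auto_derive.
Qed.

Lemma is_RInt_primitive (F f : R -> R) (a b : R) :
  (forall s, is_derive F s (f s)) -> (forall s, ex_derive f s) ->
  is_RInt (V := R_NormedModule) f a b (F b - F a).
Proof.
move=> dF df; apply: (is_RInt_derive (V := R_CompleteNormedModule)) => s _ //.
exact: (ex_derive_continuous (V := R_NormedModule)).
Qed.

Lemma is_RInt_eq (f : R -> R) (a b u v : R) :
  is_RInt (V := R_NormedModule) f a b u -> is_RInt (V := R_NormedModule) f a b v -> u = v.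
Proof.
by move=> hu hv; rewrite -(is_RInt_unique (V := R_CompleteNormedModule) _ _ _ _ hu)
  -(is_RInt_unique (V := R_CompleteNormedModule) _ _ _ _ hv).
Qed.

(** Kept multiplied by [lam], so that [lam = 0], which occurs for r < 2, needs no separate
    treatment. *)
Lemma stein_int0 lam : lam * stein_int lam 0 = 1 - exp (- lam).
Proof.
have -> : 1 - exp (- lam) = - exp (- lam * 1) - - exp (- lam * 0).
  by rewrite Rmult_0_r exp_0 Rmult_1_r; ring.
refine (is_RInt_eq (is_RInt_scal (V := R_NormedModule) _ _ _ lam _ (@is_stein_int lam 0)) _).
apply: (@is_RInt_primitive (fun s => - exp (- lam * s)) _ _ _) => s.
  by rewrite /scal /= /mult /=; auto_derive => //; ring.
by rewrite /scal /= /mult /=; auto_derive.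
Qed.

(** Integration by parts: the left side integrates the derivative of
    [- s ^ j.+1 * exp (- lam * s)]. *)
Lemma stein_intS lam j :
  lam * stein_int lam j.+1 - INR j.+1 * stein_int lam j = - exp (- lam).
Proof.
have -> : - exp (- lam) =
    - (1 ^ j.+1 * exp (- lam * 1)) - - (0 ^ j.+1 * exp (- lam * 0)).
  by rewrite pow1 Rmult_1_r /=; ring.
refine (is_RInt_eq (is_RInt_minus (V := R_NormedModule) _ _ _ _ _ _
  (is_RInt_scal (V := R_NormedModule) _ _ _ lam _ (@is_stein_int lam j.+1))
  (is_RInt_scal (V := R_NormedModule) _ _ _ (INR j.+1) _ (@is_stein_int lam j))) _).
apply: (@is_RInt_primitive (fun s => - (s ^ j.+1 * exp (- lam * s))) _ _ _) => s.
  auto_derive => //; rewrite /minus /plus /opp /scal /= /mult /=.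
  by rewrite -/(INR j.+1); ring.
by rewrite /minus /plus /opp /scal /= /mult /=; auto_derive.
Qed.

(** The difference of the integrands is [s ^ j * exp (- lam * s) * (1 - s)], between 0 and [1 - s],
    and the integral of [1 - s] is 1/2. *)
Lemma stein_int_diff lam j : 0 <= lam ->
  0 <= stein_int lam j - stein_int lam j.+1 <= / 2.
Proof.
move=> hl.
have D := is_RInt_minus (V := R_NormedModule) _ _ _ _ _ _
  (@is_stein_int lam j) (@is_stein_int lam j.+1).
have I : is_RInt (V := R_NormedModule) (fun s => 1 - s) 0 1 (/ 2).
  have -> : / 2 = (1 - 1 ^ 2 / 2) - (0 - 0 ^ 2 / 2) by field.
  by apply: (@is_RInt_primitive (fun s => s - s ^ 2 / 2) _ _ _) => s; auto_derive => //; field.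
have B s : 0 < s < 1 ->
   0 <= minus (s ^ j * exp (- lam * s)) (s ^ j.+1 * exp (- lam * s)) <= 1 - s.
  move=> hs.
  have -> : minus (s ^ j * exp (- lam * s)) (s ^ j.+1 * exp (- lam * s)) =
    (s ^ j * exp (- lam * s)) * (1 - s) by rewrite /minus /plus /opp /=; ring.
  have h1 : 0 <= s ^ j <= 1.
    by split; [apply: pow_le; lra | rewrite -(pow1 j); apply: pow_incr; lra].
  have h2 : 0 < exp (- lam * s) <= 1.
    split; first exact: exp_pos.
    rewrite -exp_0; case: (Rle_lt_or_eq_dec (- lam * s) 0) => [|h|->]; [nra| |lra].
    by left; apply: exp_increasing.
  have h3 : 0 <= s ^ j * exp (- lam * s) <= 1 by split; nra.
  by split; nra.
split.
  by apply: (is_RInt_le (fun _ => 0) _ 0 1 0 _ _ _ D) => [||s /B[]//]; [lra|];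
    have := @is_RInt_const R_NormedModule 0 1 0; rewrite /scal /= /mult /= Rmult_0_r.
by apply: (is_RInt_le _ _ 0 1 _ _ _ D I) => [|s /B[]//]; lra.
Qed.

(* The solution of the Stein equation for the indicator of [0] under Poisson([lam]);
   its value at [0] is irrelevant. *)
Definition stein (lam : R) (j : nat) : R := stein_int lam j.-1.

Lemma stein_eq lam j :
  lam * stein lam j.+1 - INR j * stein lam j = INR (j == 0%nat) - exp (- lam).
Proof.
by case: j => [|j]; rewrite /stein ?stein_int0 ?stein_intS /=; ring.
Qed.

End Stein.

(** * Error bounds *)

Import Lra.
Local Open Scope R_scope.

Definition pair_collision (n : nat) : R := 4 / 3 * (INR n - / 2) / (INR n * (INR n - 1)).

Lemma stein_ring (lam : R) (j : nat) :
  (lam * stein lam j.+1 - j%:R * stein lam j = (j == 0%N)%:R - exp (- lam))%Ri.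
Proof. by have := stein_eq lam j; rewrite !INRE. Qed.

Lemma stein_diff_ring (lam : R) (j : nat) : 0 <= lam ->
  (`|stein lam j.+1 - stein lam j.+2| <= 2^-1)%Ri.
Proof.
move=> hl; have [h1 h2] := stein_int_diff j hl.
by apply/RleP; rewrite -RabsE Rabs_pos_eq.
Qed.

Lemma INR_ge2 (n : nat) : (2 <= n)%N -> 2 <= INR n.
Proof. by move=> h; rewrite (_ : 2 = INR 2) //; apply: le_INR; apply/ssrnat.leP. Qed.

Lemma pair_collision_ge0 n : (2 <= n)%N -> 0 <= pair_collision n.
Proof.
move=> /INR_ge2 h; rewrite /pair_collision; apply: Rle_mult_inv_pos; nra.
Qed.

Lemma lamE n k : lam n k = INR 'C(n - k, 2) * pair_collision n.
Proof. by rewrite /lam /pair_collision /bin2R /Rdiv Rmult_1_l; ring. Qed.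

Lemma lam_ge0 n k : (2 <= n)%N -> 0 <= lam n k.
Proof.
move=> h; rewrite lamE; apply: Rmult_le_pos (pos_INR _) (pair_collision_ge0 h).
Qed.

Lemma IZR_ring : (IZR 3 = 3%:R)%Ri * (IZR 4 = 4%:R)%Ri.
Proof. by rewrite -!INRE /=; split; ring. Qed.

Lemma pair_collision_ring n :
  pair_collision n = (4 / 3 * (n%:R - 2^-1) / (n%:R * (n%:R - 1)))%Ri.
Proof. by rewrite /pair_collision !RdivE !INRE !IZR_ring. Qed.

Lemma stirling1_bound n k (r := (n - k)%N) : (2 <= n)%N -> (k <= n)%N ->
  Rabs (INR r`! * INR (stirling1 n k) / INR 'C(n, 2) ^ r - exp (- lam n k)) <=
  / 2 * (INR 'C(r, 2) * (INR (2 * r - 3) * pair_collision n ^ 2 +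
     INR (2 * (r - 2)) * / INR 'C(n, 2))).
Proof.
move=> hn hk.
have := @stirling1_poisson R n hn k (exp (- lam n k)) (stein (lam n k)) hk
   (fun j => stein_diff_ring j (lam_ge0 k hn)).
rewrite -pair_collision_ring -INRE -RmultE -lamE => /(_ (stein_ring _)).
rewrite INRE => h; apply/RleP; rewrite RabsE !RpowE RdivE !INRE; exact: h.
Qed.

Lemma stirling2_bound n k (r := (n - k)%N) : (2 <= n)%N -> (k <= n)%N ->
  Rabs (INR r`! * INR (stirling2 n k) / INR 'C(n, 2) ^ r - exp (- (2 * lam n k))) <=
  / 2 * (INR 'C(r, 2) * (INR (2 * r - 3) * (2 * pair_collision n) ^ 2 + 2 * / INR 'C(n, 2) +
     INR (2 * (r - 2)) * (2 * / INR 'C(n, 2) + 2 * (4 / INR n ^ 2)))).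
Proof.
move=> hn hk.
have l2 : 0 <= 2 * lam n k by have := lam_ge0 k hn; lra.
have := @stirling2_poisson R n hn k (exp (- (2 * lam n k))) (stein (2 * lam n k)) hk
   (fun j => stein_diff_ring j l2).
have lE : 2 * lam n k = (('C(n - k, 2))%:R * (2 * pair_collision n))%Ri.
  rewrite lamE -INRE -!RmultE; change (2 * (INR 'C(n - k, 2) * pair_collision n) =
    INR 'C(n - k, 2) * (2 * pair_collision n)); ring.
rewrite -pair_collision_ring -lE => /(_ (stein_ring _)).
move=> h; apply/RleP; rewrite RabsE !RpowE !RdivE !INRE IZR_ring; exact: h.
Qed.

Lemma INR_bin2 m : INR 'C(m, 2) = INR m * (INR m - 1) / 2.
Proof. by rewrite RdivE RminusE !INRE binF. Qed.

Lemma bounds_rescale (M N E a : R) : 0 < M ->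
  Rabs (N / M - exp (- a)) <= E ->
  M * exp (- a) * (1 - exp a * E) <= N /\ N <= M * exp (- a) * (1 + exp a * E).
Proof.
move=> M0 h; have h1 := Rle_abs (N / M - exp (- a)); have h2 := Rle_abs (- (N / M - exp (- a))).
rewrite Rabs_Ropp in h2.
have ea : exp (- a) * exp a = 1 by rewrite -exp_plus Rplus_opp_l exp_0.
have NE : N = M * (N / M) by field; lra.
have -> : M * exp (- a) * (1 - exp a * E) = M * (exp (- a) - E).
  by rewrite (_ : _ * (1 - _) = M * (exp (- a) - (exp (- a) * exp a) * E)); [rewrite ea Rmult_1_l | ring].
have -> : M * exp (- a) * (1 + exp a * E) = M * (exp (- a) + E).
  by rewrite (_ : _ * (1 + _) = M * (exp (- a) + (exp (- a) * exp a) * E)); [rewrite ea Rmult_1_l | ring].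
by rewrite NE; split; apply: Rmult_le_compat_l; lra.
Qed.


Lemma INR_2r3 r : (2 <= r)%N -> INR (2 * r - 3) = 2 * INR r - 3.
Proof.
move=> h; rewrite minus_INR ?mult_INR /=; first by lra.
by apply/ssrnat.leP; case: r h => [|[|m]] // _; rewrite mulnS.
Qed.

Lemma INR_2r4 r : (2 <= r)%N -> INR (2 * (r - 2)) = 2 * (INR r - 2).
Proof. by move=> h; rewrite mult_INR minus_INR //=; apply/ssrnat.leP. Qed.

Lemma stirling1_error n k (r := (n - k)%N) : (2 <= n)%N ->
  / 2 * (INR 'C(r, 2) * (INR (2 * r - 3) * pair_collision n ^ 2 +
     INR (2 * (r - 2)) * / INR 'C(n, 2))) <= f1 n k + f2 n k.
Proof.
move=> hn; have n2 := INR_ge2 hn; rewrite /f1 /f2 /bin2R -/r.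
have -> : 4 / (3 * INR n) * ((INR n - 1 / 2) / (INR n - 1)) = pair_collision n.
  by rewrite /pair_collision; field; lra.
(* For r < 2 the truncated [2 * r - 3] differs from the real one, but the binomial factor vanishes
   on both sides. *)
case: (ltnP r 2) => hr; first by rewrite (bin_small hr) /=; lra.
have r2 := INR_ge2 hr.
rewrite INR_2r3 // INR_2r4 // /Rdiv.
have N0 : 0 < / INR 'C(n, 2) by apply: Rinv_0_lt_compat; rewrite INR_bin2; nra.
have := pow2_ge_0 (pair_collision n); have := pos_INR 'C(r, 2).
move: (pair_collision n ^ 2) (INR 'C(r, 2)) (/ INR 'C(n, 2)) N0 => q c v v0 c0 q0.
have cq : 0 <= c * q by nra.
have cv : 0 <= c * v by nra.
nra.
Qed.

Lemma stirling2_error n k (r := (n - k)%N) : (2 <= n)%N ->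
  / 2 * (INR 'C(r, 2) * (INR (2 * r - 3) * (2 * pair_collision n) ^ 2 + 2 * / INR 'C(n, 2) +
     INR (2 * (r - 2)) * (2 * / INR 'C(n, 2) + 2 * (4 / INR n ^ 2)))) <= c1A n k + c2A n k.
Proof.
move=> hn; have n2 := INR_ge2 hn; rewrite /c1A /c2A -/r.
set x := INR n in n2 *; set q := pair_collision n ^ 2; set v := / INR 'C(n, 2).
have -> : INR r * (INR r - 1) * (INR r - 3 / 2) * (64 / (9 * x ^ 2)) *
    ((x - 1 / 2) ^ 2 / (x - 1) ^ 2) = INR r * (INR r - 1) * (INR r - 3 / 2) * (4 * q).
  by rewrite /q /pair_collision -/x; field; lra.
set B := 40 / (3 * x ^ 2) * ((x * (x - 17 / 5) + 17 / 5) / (x - 1) ^ 2).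
have -> : INR r * (INR r - 1) * (INR r - 2) * (40 / (3 * x ^ 2)) *
    ((x * (x - 17 / 5) + 17 / 5) / (x - 1) ^ 2) =
    INR r * (INR r - 1) * (INR r - 2) * B by rewrite /B; ring.
case: (ltnP r 2) => hr.
  rewrite (bin_small hr) /=; case: r hr => [|[|m]] //= _; lra.
have r2 := INR_ge2 hr.
(* The ratio of [2 * q] to [v] is 16/9 times (x - 1/2)^2 / (x(x - 1)), and (x - 1/2)^2 = x(x - 1) +
   1/4. *)
have vq : v <= 2 * q.
  have -> : v = / (x * (x - 1) / 2) by rewrite /v INR_bin2.
  have -> : 2 * q = / (x * (x - 1) / 2) * (16 / 9 * ((x - / 2) ^ 2 / (x * (x - 1)))).
    by rewrite /q /pair_collision -/x; field; lra.
  have i0 : 0 < / (x * (x - 1) / 2) by apply: Rinv_0_lt_compat; nra.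
  have : 1 <= (x - / 2) ^ 2 / (x * (x - 1)).
    apply: (Rmult_le_reg_r (x * (x - 1))); first by nra.
    rewrite /Rdiv Rmult_assoc Rinv_l; nra.
  nra.
have B4 : 4 / x ^ 2 <= B.
  rewrite /B; have -> : 4 / x ^ 2 = / (x ^ 2 * (x - 1) ^ 2) * (4 * (x - 1) ^ 2) by field; lra.
  have -> : 40 / (3 * x ^ 2) * ((x * (x - 17 / 5) + 17 / 5) / (x - 1) ^ 2) =
    / (x ^ 2 * (x - 1) ^ 2) * (40 / 3 * (x * (x - 17 / 5) + 17 / 5)) by field; lra.
  (* The difference of the two quadratics is (28/3)(x - 2)^2 + 4. *)
  apply: Rmult_le_compat_l; last by nra.
  by apply: Rlt_le; apply: Rinv_0_lt_compat; nra.
rewrite INR_2r3 // INR_2r4 // INR_bin2 Rpow_mult_distr -/q.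
have w0 : 0 <= INR r * (INR r - 1) by nra.
move: (4 / x ^ 2) B4 w0 r2 vq => u; move: (INR r) => y uB w0 y2 vq.
(* The shared-cell event contributes [v / 2], which turns [(y - 2) * v] into [(y - 3 / 2) * v]. This
   is the coefficient of [2 * q], so [vq] absorbs it into [c1A], and the mixed chains [u] go into
   [c2A]. *)
have -> : / 2 * (y * (y - 1) / 2 * ((2 * y - 3) * (2 ^ 2 * q) + 2 * v +
   2 * (y - 2) * (2 * v + 2 * u))) =
   y * (y - 1) * ((y - 3 / 2) * (2 * q) + (y - 3 / 2) * v + (y - 2) * u) by field.
have -> : y * (y - 1) * (y - 3 / 2) * (4 * q) + y * (y - 1) * (y - 2) * B =
   y * (y - 1) * ((y - 3 / 2) * (2 * q) + (y - 3 / 2) * (2 * q) + (y - 2) * B) by ring.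
apply: Rmult_le_compat_l => //.
have := Rmult_le_compat_l (y - 3 / 2) _ _ _ vq.
have := Rmult_le_compat_l (y - 2) _ _ _ uB; lra.
Qed.

Lemma mainterm_gt0 n k : (2 <= n)%N -> 0 < mainterm n k.
Proof.
move=> /INR_ge2 h; rewrite /mainterm /bin2R; apply: Rdiv_lt_0_compat.
  by apply: pow_lt; rewrite INR_bin2; nra.
by apply: lt_0_INR; apply/ssrnat.ltP; apply: fact_gt0.
Qed.

Lemma div_mainterm n k (s : nat) : (2 <= n)%N ->
  INR s / mainterm n k = INR ((n - k)`!)%N * INR s / INR 'C(n, 2) ^ (n - k).
Proof.
move=> /INR_ge2 h; rewrite /mainterm /bin2R.
have f0 : INR (n - k)`! <> 0 by apply: not_0_INR; apply/eqP; rewrite -lt0n fact_gt0.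
have N0 : INR 'C(n, 2) ^ (n - k) <> 0 by apply: pow_nonzero; rewrite INR_bin2; nra.
by field.
Qed.

Theorem theorem5p2 (n k : nat) (hn : (2 <= n)%N) (hk1 : (1 <= k)%N) (hkn : (k <= n)%N) :
  (mainterm n k * exp (- lam n k) * (1 - exp (lam n k) * (f1 n k + f2 n k))
     <= INR (stirling1 n k)
   /\ INR (stirling1 n k)
     <= mainterm n k * exp (- lam n k) * (1 + exp (lam n k) * (f1 n k + f2 n k)))%R
  /\
  (mainterm n k * exp (- (2 * lam n k)) * (1 - exp (2 * lam n k) * (c1A n k + c2A n k))
     <= INR (stirling2 n k)
   /\ INR (stirling2 n k)
     <= mainterm n k * exp (- (2 * lam n k)) * (1 + exp (2 * lam n k) * (c1A n k + c2A n k)))%R.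
Proof.
have M0 := mainterm_gt0 k hn.
split; apply: bounds_rescale => //; rewrite div_mainterm //.
  exact: Rle_trans (stirling1_bound hn hkn) (stirling1_error _ hn).
exact: Rle_trans (stirling2_bound hn hkn) (stirling2_error _ hn).
Qed.
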